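(* Let $X$ be a germ at $0\in\mathbb{C}^n$ of holomorphic vector field, $X\not\equiv0$. If $r(X)=n$, then there exists a germ at $0\in\mathbb{C}^n$ of closed meromorphic $(n-1)$-form $\eta\not\equiv0$ annihilating $X$, i.e. $d\eta=0$ and $i_X\eta=0$.
   Context: $\mathcal{X}_n$ is the set of germs at $0\in\mathbb{C}^n$ of holomorphic vector fields. For $X\in\mathcal{X}_n$, $C(X)=\{Y\in\mathcal{X}_n\mid[X,Y]=0\}$, and $r(X)$ is the maximal $r$ such that there exist $Y_1,\dots,Y_r\in C(X)$ with $Y_1\wedge\dots\wedge Y_r\not\equiv0$. $i_X$ denotes the interior product with $X$. *)

(* Defs.v *)
From HB Require Import structures.
From mathcomp Require Import all_boot all_order all_algebra.
From mathcomp Require Import complex.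
From mathcomp Require Import all_classical all_reals.
From mathcomp Require Import topology normedtype derive.

Set Implicit Arguments.
Unset Strict Implicit.
Unset Printing Implicit Defensive.

Import Order.TTheory GRing.Theory Num.Theory.
Import numFieldNormedType.Exports.

Local Open Scope classical_set_scope.
Local Open Scope ring_scope.

(* Germs at 0 are handled through representatives: total functions whose values
   matter only near 0.  All the notions below depend on the germ alone. *)

(* The cast gives R[i] the topology and norm of a numFieldType, so that
   [differentiable] and ['d] are complex (C-linear) differentiability. *)
Definition Cx (R : realType) : numFieldType := R[i].

Notation Cn R n := 'rV[Cx R]_n.

Definition holomorphic_near0 (R : realType) (n : nat)
    (W : normedModType (Cx R)) (f : Cn R n -> W) : Prop :=
  \forall z \near (0 : Cn R n), differentiable f z.

Definition vanishes_near0 (R : realType) (n : nat) (W : zmodType)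
    (f : Cn R n -> W) : Prop :=
  \forall z \near (0 : Cn R n), f z = 0.

Record hvfield (R : realType) (n : nat) := HVField {
  vf :> Cn R n -> Cn R n;
  vf_hol : holomorphic_near0 vf
}.

Definition lie_bracket (R : realType) (n : nat) (X Y : Cn R n -> Cn R n)
    (z : Cn R n) : Cn R n :=
  'd Y z (X z) - 'd X z (Y z).

Definition centralizer (R : realType) (n : nat) (X : hvfield R n) :
    set (hvfield R n) :=
  [set Y | vanishes_near0 (lie_bracket X Y)].

(* The r-vector Y_1 /\ ... /\ Y_r at z, as an alternating form in r covectors
   a_1, ..., a_r (the columns of A): its value is \det (a_j (Y_i z))_{i,j}. *)
Definition wedge (R : realType) (n r : nat) (Y : 'I_r -> Cn R n -> Cn R n)
    (z : Cn R n) (A : 'M[Cx R]_(n, r)) : Cx R :=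
  \det ((\matrix_(i < r) Y i z) *m A).

Definition has_indep_centralizer (R : realType) (n : nat) (X : hvfield R n)
    (r : nat) : Prop :=
  exists Y : 'I_r -> hvfield R n,
    (forall i, centralizer X (Y i)) /\
    ~ (\forall z \near (0 : Cn R n), forall A, wedge Y z A = 0).

Lemma has_indep_centralizer0 (R : realType) (n : nat) (X : hvfield R n) :
  exists r, `[< has_indep_centralizer X r >].
Proof.
exists 0%N; apply/asboolP; exists (fun=> X); split; first by case.
move=> /nbhs_singleton /(_ 0) /eqP.
by rewrite /wedge det_mx00 oner_eq0.
Qed.

Lemma has_indep_centralizer_le (R : realType) (n : nat) (X : hvfield R n)
    (r : nat) :
  `[< has_indep_centralizer X r >] -> (r <= n)%N.
Proof.
move=> /asboolP[Y [_ Yn0]]; rewrite leqNgt; apply/negP => ltnr; apply: Yn0.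
apply: filterE => z A; apply/eqP; apply: contraTT ltnr => detN0.
rewrite -leqNgt; have : (\matrix_(i < r) Y i z) *m A \in unitmx.
  by rewrite unitmxE unitfE.
move=> /mxrank_unit <-.
by apply: leq_trans (mxrankM_maxl _ _) _; apply: rank_leq_col.
Qed.

Definition r_max (R : realType) (n : nat) (X : hvfield R n) : nat :=
  ex_maxn (has_indep_centralizer0 X) (@has_indep_centralizer_le R n X).

(* Alternating k-forms on C^n, the k vector arguments being the rows of A. *)
Definition altform (R : realType) (n k : nat)
    (w : 'M[Cx R]_(k, n) -> Cx R) : Prop :=
  (forall (A : 'M[Cx R]_(k, n)) (i : 'I_k) (a : Cx R) (u v : Cn R n),
     let upd x := \matrix_(j < k) (if j == i then x else row j A) in
     w (upd (a *: u + v)) = a * w (upd u) + w (upd v)) /\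
  (forall (A : 'M[Cx R]_(k, n)) (i j : 'I_k),
     i != j -> row i A = row j A -> w A = 0).

Definition formfield (R : realType) (n k : nat) : Type :=
  Cn R n -> 'M[Cx R]_(k, n) -> Cx R.

(* (dw)_z(v_0, ..., v_k) =
     \sum_i (-1)^i (D_{v_i} w)_z(v_0, ..., v_{i-1}, v_{i+1}, ..., v_k) *)
Definition extd (R : realType) (n k : nat) (w : formfield R n k) :
    formfield R n k.+1 :=
  fun z A => \sum_(i < k.+1)
    (-1) ^+ i * 'd (fun x => w x (row' i A) : (Cx R)^o) z (row i A).

(* On 0-forms the interior product is 0. *)
Definition interior (R : realType) (n k : nat) (X : Cn R n -> Cn R n) :
    formfield R n k -> formfield R n k.-1 :=
  match k with
  | 0 => fun _ _ _ => 0
  | k'.+1 => fun w z A => w z (col_mx (X z) A : 'M_(1 + k', n))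
  end.

(* A germ of meromorphic k-form is w / g, with w a holomorphic k-form and g a
   holomorphic function that is not identically 0 near 0 (a common denominator
   of the coefficients). *)
Record mform (R : realType) (n k : nat) := MForm {
  mnum : formfield R n k;
  mden : Cn R n -> (Cx R)^o;
  mnum_alt : \forall z \near (0 : Cn R n), altform (mnum z);
  mnum_hol : \forall z \near (0 : Cn R n),
    forall A, differentiable (fun x => mnum x A : (Cx R)^o) z;
  mden_hol : holomorphic_near0 mden;
  mden_neq0 : ~ vanishes_near0 mden
}.

Definition mval (R : realType) (n k : nat) (eta : mform R n k) :
    formfield R n k :=
  fun z A => mnum eta z A / mden eta z.

(* By the identity theorem {mden eta <> 0} is open and dense near 0, so a
   meromorphic form vanishes iff it vanishes on this set; the values of [mval]
   elsewhere are meaningless. *)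
Definition vanishes_off_poles (R : realType) (n k l : nat) (eta : mform R n k)
    (w : formfield R n l) : Prop :=
  \forall z \near (0 : Cn R n), mden eta z != 0 -> forall A, w z A = 0.

Definition mzero (R : realType) (n k : nat) (eta : mform R n k) : Prop :=
  vanishes_off_poles eta (mval eta).

Definition mclosed (R : realType) (n k : nat) (eta : mform R n k) : Prop :=
  vanishes_off_poles eta (extd (mval eta)).

Definition mannihilates (R : realType) (n k : nat) (eta : mform R n k)
    (X : hvfield R n) : Prop :=
  vanishes_off_poles eta (interior X (mval eta)).

(* Main.v *)
(* Let Y_1, ..., Y_n commute with X, with D = det (Y_1, ..., Y_n) not identically
   0.  The n-form vol / D takes the value 1 on (Y_1, ..., Y_n), hence is invariant
   under the flow of X, and the form eta = i_X vol / D is closed.  Infinitesimally,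
   X(D) = div(X) D because [X, Y_i] = 0, and this cancels d(i_X vol) = div(X) vol.

   That eta is not 0 requires the ring of germs of holomorphic functions to be an
   integral domain.  On a complex line through a point where the first factor is
   not 0, the second factor is a function g of one variable, differentiable for
   |t| <= 7 and vanishing near 0, and one has to show g(1) = 0.  A Cauchy estimate
   applied to g(t) / t^n around 1 gives |g(1)| <= 4 sup|g| / 2^n for all n.

   The Cauchy estimate is proved without integrals: midpoint Riemann sums of level
   N are exact on affine functions and additive under bisection, so that Goursat's
   subdivision argument shows that they tend to 0 along triangles. *)
Require Import Defs.
From mathcomp Require Import all_boot all_order all_algebra perm complex ring lra.
From mathcomp Require Import all_classical all_reals topology normedtype derive.

Set Implicit Arguments.
Unset Strict Implicit.
Unset Printing Implicit Defensive.

Import Order.TTheory GRing.Theory Num.Theory.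
Import numFieldNormedType.Exports.

Local Open Scope classical_set_scope.
Local Open Scope ring_scope.

(** * Midpoint sums and Goursat's lemma *)

Section MidpointSums.
Variable K : numFieldType.
Implicit Types (h f g : K -> K) (a b c : K).

Definition midpt a b := (a + b) / 2.

(** Midpoint Riemann sum, with 2^N equal pieces, of the integral of [h] along the segment from [a]
    to [b]. Recursion by bisection makes additivity hold by computation. *)
Fixpoint midsum h N a b : K :=
  if N is N'.+1 then midsum h N' a (midpt a b) + midsum h N' (midpt a b) b
  else h (midpt a b) * (b - a).

Lemma midptC a b : midpt a b = midpt b a.
Proof. by rewrite /midpt addrC. Qed.

Lemma midsumC h N a b : midsum h N b a = - midsum h N a b.
Proof.
elim: N a b => [|N IH] a b /=; first by rewrite midptC -mulrN opprB.
by rewrite midptC (IH (midpt a b) b) (IH a) opprD addrC.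
Qed.

Lemma midsumD f g N a b :
  midsum (fun z => f z + g z) N a b = midsum f N a b + midsum g N a b.
Proof.
elim: N a b => [|N IH] a b /=; first by rewrite mulrDl.
by rewrite !IH addrACA.
Qed.

Lemma midsumZ k f N a b :
  midsum (fun z => k * f z) N a b = k * midsum f N a b.
Proof.
elim: N a b => [|N IH] a b /=; first by rewrite mulrA.
by rewrite !IH mulrDr.
Qed.

(** The midpoints of the two halves average to the midpoint of the whole segment, so bisection does
    not change the value. *)
Lemma midsum_affine k l N a b :
  midsum (fun z => k + l * z) N a b = (k + l * midpt a b) * (b - a).
Proof.
elim: N a b => [|N IH] a b //=; rewrite !IH /midpt.
by field; rewrite ?pnatr_eq0.
Qed.

(** A form of convexity adapted to [midsum], which evaluates its function only at iterated
    midpoints. *)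
Definition midconvex (D : set K) := forall a b, D a -> D b -> D (midpt a b).

Definition trisum h N a b c :=
  midsum h N a b + midsum h N b c + midsum h N c a.

(** The three inner edges are each run through in both directions, so they cancel. *)
Lemma trisumS h N a b c :
  trisum h N.+1 a b c =
    trisum h N a (midpt a b) (midpt c a) +
    trisum h N (midpt a b) b (midpt b c) +
    trisum h N (midpt c a) (midpt b c) c +
    trisum h N (midpt a b) (midpt b c) (midpt c a).
Proof.
rewrite /trisum /= (midsumC h N (midpt a b) (midpt c a)).
rewrite (midsumC h N (midpt b c) (midpt c a)).
by rewrite (midsumC h N (midpt a b) (midpt b c)); ring.
Qed.

End MidpointSums.

(** * Real-valued modulus, and size estimates for midpoint sums *)

Section ComplexNorm.
Variable R : realType.
Local Notation C := (Cx R).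
Implicit Types (z w : C).

(* The norm of Cx R has values in Cx R, whose order is partial; nm is its real
   version. *)
Definition nm z : R := complex.Re `|z|.

Lemma nmE z : `|z| = (nm z)%:C%C :> C.
Proof. by rewrite /nm; apply/eqP; rewrite eq_complex /= !eqxx. Qed.

Lemma nm_le z (r : R) : (`|z| <= (r%:C%C : C)) = (nm z <= r).
Proof. by rewrite nmE lecR. Qed.

Lemma nm_lt z (r : R) : (`|z| < (r%:C%C : C)) = (nm z < r).
Proof. by rewrite nmE ltcR. Qed.

Lemma nmD z w : nm (z + w) <= nm z + nm w.
Proof. by rewrite -nm_le rmorphD /= -!nmE ler_normD. Qed.

Lemma nmM z w : nm (z * w) = nm z * nm w.
Proof. by apply: complexI; rewrite rmorphM /= -!nmE normrM. Qed.

Lemma nmN z : nm (- z) = nm z.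
Proof. by rewrite /nm normrN. Qed.

Lemma nmB z w : nm (z - w) = nm (w - z).
Proof. by rewrite -nmN opprB. Qed.

Lemma nm0 : nm 0 = 0.
Proof. by rewrite /nm normr0. Qed.

Lemma nm1 : nm 1 = 1.
Proof. by rewrite /nm normr1. Qed.

Lemma nm_ge0 z : 0 <= nm z.
Proof. by rewrite -lecR -nmE normr_ge0. Qed.

Lemma nmV z : nm z^-1 = (nm z)^-1.
Proof. by apply: complexI; rewrite fmorphV /= -!nmE normfV. Qed.

Lemma nmX z n : nm (z ^+ n) = nm z ^+ n.
Proof. by apply: complexI; rewrite rmorphXn /= -!nmE normrX. Qed.

Lemma nm_eq0 z : (nm z == 0) = (z == 0).
Proof. by rewrite -(inj_eq (@complexI R)) -nmE normr_eq0. Qed.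

Lemma nm_gt0 z : (0 < nm z) = (z != 0).
Proof. by rewrite lt_def nm_ge0 nm_eq0 andbT. Qed.

Lemma nmM2 z : nm (z / 2) = nm z / 2.
Proof. by rewrite nmM nmV; congr (_ / _); rewrite /nm normr_nat. Qed.

Lemma ler_Re_nm z : `|complex.Re z| <= nm z.
Proof. by rewrite -lecR -nmE normc_ge_Re. Qed.

Lemma nm_split z : nm z <= `|complex.Re z| + `|complex.Im z|.
Proof.
rewrite /nm normc_def /=.
rewrite -[leRHS]ger0_norm ?addr_ge0// -sqrtr_sqr ler_wsqrtr//.
rewrite sqrrD !real_normK ?num_real// lerD2r lerDl.
by rewrite mulrn_wge0// mulr_ge0.
Qed.

Lemma ler_Im_nm z : `|complex.Im z| <= nm z.
Proof.
rewrite /nm normc_def /= -sqrtr_sqr ler_wsqrtr// lerDr sqr_ge0 //.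
Qed.

Lemma midpt_nm (p : C) (r : R) : midconvex [set z | nm (z - p) <= r].
Proof.
move=> a b /= ha hb; rewrite /midpt.
have -> : (a + b) / 2 - p = (a - p + (b - p)) / 2 :> C.
  by field; rewrite ?pnatr_eq0.
rewrite nmM2; have := nmD (a - p) (b - p); lra.
Qed.

Lemma nm_midsum (D : set C) (h : C -> C) (M : R) N a b : midconvex D ->
  (forall z, D z -> nm (h z) <= M) -> D a -> D b ->
  nm (midsum h N a b) <= M * nm (b - a).
Proof.
move=> cD hM; elim: N a b => [|N IH] a b Da Db /=.
  by rewrite nmM ler_wpM2r ?nm_ge0// hM//; exact: cD.
have Dm : D (midpt a b) by exact: cD.
apply: le_trans (nmD _ _) _.
have := IH _ _ Da Dm; have := IH _ _ Dm Db.
have -> : midpt a b - a = (b - a) / 2 by rewrite /midpt; field; rewrite ?pnatr_eq0.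
have -> : b - midpt a b = (b - a) / 2 by rewrite /midpt; field; rewrite ?pnatr_eq0.
rewrite nmM2; lra.
Qed.

Definition perimeter (a b c : C) : R := nm (b - a) + nm (c - b) + nm (a - c).

Lemma perimeter_ge0 a b c : 0 <= perimeter a b c.
Proof. by rewrite !addr_ge0 ?nm_ge0. Qed.

Lemma nm_trisum (D : set C) (h : C -> C) (M : R) N a b c : midconvex D ->
  (forall z, D z -> nm (h z) <= M) -> D a -> D b -> D c ->
  nm (trisum h N a b c) <= M * perimeter a b c.
Proof.
move=> cD hM Da Db Dc; rewrite /trisum /perimeter.
have := nm_midsum N cD hM Da Db; have := nm_midsum N cD hM Db Dc.
have := nm_midsum N cD hM Dc Da.
have := nmD (midsum h N a b + midsum h N b c) (midsum h N c a).
have := nmD (midsum h N a b) (midsum h N b c).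
lra.
Qed.

Lemma midptBl (a b c : C) : midpt a b - midpt c a = (b - c) / 2.
Proof. by rewrite /midpt; field; rewrite ?pnatr_eq0. Qed.

Lemma midptB1 (a b : C) : midpt a b - a = (b - a) / 2.
Proof. by rewrite /midpt; field; rewrite ?pnatr_eq0. Qed.

Lemma midptB2 (a b : C) : b - midpt a b = (b - a) / 2.
Proof. by rewrite /midpt; field; rewrite ?pnatr_eq0. Qed.

(** Every side of a child is a translate, up to orientation, of half a side of the parent. *)
Lemma perimeter_child (a b c : C) :
  [/\ perimeter a (midpt a b) (midpt c a) = perimeter a b c / 2,
      perimeter (midpt a b) b (midpt b c) = perimeter a b c / 2,
      perimeter (midpt c a) (midpt b c) c = perimeter a b c / 2 &
      perimeter (midpt a b) (midpt b c) (midpt c a) = perimeter a b c / 2].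
Proof.
rewrite /perimeter.
rewrite (nmB (midpt c a) (midpt a b)) (nmB (midpt b c) (midpt a b)).
rewrite (nmB (midpt c a) (midpt b c)).
rewrite (nmB (midpt a b) (midpt b c)) (nmB (midpt b c) (midpt c a)).
rewrite !midptBl !midptB1 !midptB2 !nmM2.
rewrite (nmB b c) (nmB c a) (nmB a b).
by split; lra.
Qed.

End ComplexNorm.

(** * Sequences with geometrically decreasing steps *)

Section GeometricCauchy.
Variable R : realType.

(** With [e k] = 2P / 2^k, the intervals [u k - e k, u k + e k] are nested; the limit is the
    supremum of their left endpoints. *)
Lemma geometric_cauchy (u : nat -> R) (P : R) :
  (forall k, `|u k.+1 - u k| <= P / 2 ^+ k) ->
  exists l, forall k, `|u k - l| <= 2 * P / 2 ^+ k.
Proof.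
move=> hu.
have P0 : 0 <= P by have := le_trans (normr_ge0 _) (hu 0%N); rewrite expr0 divr1.
pose e k := 2 * P / 2 ^+ k : R.
have eS k : e k.+1 = e k / 2 by rewrite /e exprS invfM; lra.
have step k : `|u k.+1 - u k| <= e k / 2 by have := hu k; rewrite /e; lra.
have lo k j : u k - e k <= u (k + j)%N - e (k + j)%N.
  elim: j => [|j IH]; first by rewrite addn0.
  rewrite addnS eS; have := step (k + j)%N; rewrite ler_norml => /andP[]; lra.
have hi k j : u (k + j)%N + e (k + j)%N <= u k + e k.
  elim: j => [|j IH]; first by rewrite addn0.
  rewrite addnS eS; have := step (k + j)%N; rewrite ler_norml => /andP[]; lra.
have e0 k : 0 <= e k by rewrite /e divr_ge0 ?mulr_ge0 ?exprn_ge0.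
have lohi k j : u k - e k <= u j + e j.
  have := lo k j; have := hi j k; rewrite addnC; have := e0 (k + j)%N; lra.
pose A := range (fun k => u k - e k).
have A0 : A !=set0 by exists (u 0%N - e 0%N); exists 0%N.
have ubA j : ubound A (u j + e j) by move=> _ [k _ <-].
exists (sup A) => k; rewrite ler_norml.
have : u k - e k <= sup A.
  by apply: ub_le_sup; [exists (u 0%N + e 0%N) | exists k].
have : sup A <= u k + e k by apply: ge_sup.
rewrite -/(e k); lra.
Qed.

Lemma geometric_lt (P d : R) : 0 < d -> exists k, P / 2 ^+ k < d.
Proof.
move=> d0; have [k hk] : exists k : nat, `|P| / d < k%:R.
  by exists (Num.bound (`|P| / d)); apply: archi_boundP; rewrite divr_ge0// ltW.
exists k; rewrite ltr_pdivrMr ?exprn_gt0//; apply: le_lt_trans (ler_norm _) _.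
move: hk; rewrite ltr_pdivrMr// mulrC => /lt_le_trans; apply.
rewrite ler_pM2l// -natrX ler_nat; exact/ltnW/ltn_expl.
Qed.

End GeometricCauchy.

(** * Goursat's subdivision argument for midpoint sums *)

Section Goursat.
Variable R : realType.
Local Notation C := (Cx R).

Lemma geometric_cauchyC (u : nat -> C) (P : R) :
  (forall k, nm (u k.+1 - u k) <= P / 2 ^+ k) ->
  exists l : C, forall k, nm (u k - l) <= 4 * P / 2 ^+ k.
Proof.
move=> hu.
have [x hx] : exists x, forall k, `|complex.Re (u k) - x| <= 2 * P / 2 ^+ k.
  apply: geometric_cauchy => k; rewrite -raddfB.
  exact: le_trans (ler_Re_nm _) (hu k).
have [y hy] : exists y, forall k, `|complex.Im (u k) - y| <= 2 * P / 2 ^+ k.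
  apply: geometric_cauchy => k; rewrite -raddfB.
  exact: le_trans (ler_Im_nm _) (hu k).
exists (complex.Complex x y) => k; apply: le_trans (nm_split _) _.
rewrite !raddfB /=; have := hx k; have := hy k; lra.
Qed.

Lemma derivable_approx (h : C -> C) (p : C) : derivable h p 1 ->
  exists l : C, forall e : R, 0 < e -> exists2 d : R, 0 < d &
    forall z, nm (z - p) < d -> nm (h z - (h p + l * (z - p))) <= e * nm (z - p).
Proof.
move=> /cvg_ex[l hl]; exists l => e e0.
have e0C : 0 < (e%:C%C : C) by rewrite ltcR.
move/cvgrPdist_le: hl => /(_ _ e0C).
move=> /nbhs_ballP[d /= d0].
(* The radius [d] is an element of [Cx R]; being positive, it equals its own norm, and [nm d] is the
   same radius as a real number. *)
rewrite -(gtr0_norm d0) nmE => hd.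
exists (nm d) => [|z hz]; first by rewrite nm_gt0 gt_eqF.
have [->|zp] := eqVneq z p; first by rewrite subrr mulr0 addr0 subrr nm0 mulr0.
have zp0 : z - p != 0 by rewrite subr_eq0.
have := hd (z - p); rewrite -ball_normE /ball_ /= sub0r normrN nm_lt => /(_ hz zp0).

rewrite nm_le /= => le_e.
have -> : h z - (h p + l * (z - p)) = - (l - (z - p)^-1 * (h z - h p)) * (z - p).
  by field.
rewrite nmM nmN ler_wpM2r ?nm_ge0//; move: le_e.
by rewrite /GRing.scale /= mulr1 subrK.
Qed.

(** Statements about integrals become bounds valid at all large levels; no limit of sums is
    formed. *)
Definition eventually_le (u : nat -> C) (e : R) :=
  exists N0, forall N, (N0 <= N)%N -> nm (u N) <= e.

Lemma eventually_leS (u : nat -> C) e :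
  eventually_le (fun N => u N.+1) e -> eventually_le u e.
Proof. by case=> N0 h; exists N0.+1 => -[|N] // /h. Qed.

Lemma eventually_leD (u v : nat -> C) e f :
  eventually_le u e -> eventually_le v f ->
  eventually_le (fun N => u N + v N) (e + f).
Proof.
case=> N1 h1 [N2 h2]; exists (maxn N1 N2) => N; rewrite geq_max => /andP[/h1 ? /h2 ?].
by apply: le_trans (nmD _ _) _; rewrite lerD.
Qed.

Lemma eventually_le_ext (u v : nat -> C) e : u =1 v ->
  eventually_le u e -> eventually_le v e.
Proof. by move=> uv [N0 h]; exists N0 => N /h; rewrite uv. Qed.

Lemma eventually_le_le (u : nat -> C) e f : e <= f ->
  eventually_le u e -> eventually_le u f.
Proof. by move=> ef [N0 h]; exists N0 => N /h /le_trans; apply. Qed.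

Definition seq_closed (D : set C) :=
  forall p, (forall e : R, 0 < e -> exists2 z, D z & nm (z - p) < e) -> D p.

(** The bound is compatible with subdivision: four children of half the perimeter have bounds adding
    up to exactly that of the parent. Hence a triangle violating it has a violating child. Iteration
    gives triangles shrinking to a point [p] of [D], where differentiability contradicts the
    violation. *)
Lemma goursat (D : set C) (h : C -> C) (a b c : C) (e : R) :
  midconvex D -> seq_closed D -> (forall z, D z -> derivable h z 1) ->
  D a -> D b -> D c -> 0 < e ->
  eventually_le (fun N => trisum h N a b c) (e * perimeter a b c ^+ 2).
Proof.
move=> cD clD hD Da Db Dc e0; apply: contrapT => bad0.
pose inD (t : C * C * C) := [/\ D t.1.1, D t.1.2 & D t.2].
pose per (t : C * C * C) := perimeter t.1.1 t.1.2 t.2.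
pose ev (t : C * C * C) :=
  eventually_le (fun N => trisum h N t.1.1 t.1.2 t.2) (e * per t ^+ 2).
(* [f] picks a violating child. The bound on the displacement of the first vertex makes the first
   vertices of the iterates a Cauchy sequence. *)
have /choice[f hf] : forall t, exists t', inD t /\ ~ ev t ->
    [/\ inD t', ~ ev t', per t' = per t / 2 & nm (t'.1.1 - t.1.1) <= per t].
  move=> [[x y] z].
  have [[[/= Dx Dy Dz] bad]|nb] := pselect (inD (x, y, z) /\ ~ ev (x, y, z));
    last first.
    by exists (x, y, z) => /nb.
  have Dxy := cD _ _ Dx Dy; have Dyz := cD _ _ Dy Dz; have Dzx := cD _ _ Dz Dx.
  have [p1 p2 p3 p4] := perimeter_child x y z.
  have nx : nm (x - x) <= perimeter x y z by rewrite subrr nm0 perimeter_ge0.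
  have nxy : nm (midpt x y - x) <= perimeter x y z.
    rewrite midptB1 nmM2 /perimeter.
    have := nm_ge0 (y - x); have := nm_ge0 (z - y); have := nm_ge0 (x - z); lra.
  have nzx : nm (midpt z x - x) <= perimeter x y z.
    rewrite midptC midptB1 nmM2 /perimeter nmB.
    have := nm_ge0 (y - x); have := nm_ge0 (z - y); have := nm_ge0 (x - z); lra.
  have [e1|] := pselect (ev (x, midpt x y, midpt z x)); last first.
    by exists (x, midpt x y, midpt z x); split.
  have [e2|] := pselect (ev (midpt x y, y, midpt y z)); last first.
    by exists (midpt x y, y, midpt y z); split.
  have [e3|] := pselect (ev (midpt z x, midpt y z, z)); last first.
    by exists (midpt z x, midpt y z, z); split.
  have [e4|] := pselect (ev (midpt x y, midpt y z, midpt z x)); last first.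
    by exists (midpt x y, midpt y z, midpt z x); split.
  exfalso; apply: bad; apply: eventually_leS.
  apply: (eventually_le_ext (fun N => esym (trisumS h N x y z))).
  have := eventually_leD (eventually_leD (eventually_leD e1 e2) e3) e4.
  apply: eventually_le_le; rewrite /per /= p1 p2 p3 p4; lra.
pose t k := iter k f (a, b, c).
have bad k : inD (t k) /\ ~ ev (t k).
  by elim: k => [|k /hf[]] //=.
have tS k := hf _ (bad k).
have perE k : per (t k) = perimeter a b c / 2 ^+ k.
  elim: k => [|k IH]; first by rewrite expr0 divr1.
  by have [_ _ -> _] := tS k; rewrite IH exprS invfM; lra.
set P := perimeter a b c in perE.
have P0 : 0 <= P by exact: perimeter_ge0.
have [p hp] : exists p, forall k, nm ((t k).1.1 - p) <= 4 * P / 2 ^+ k.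
  by apply: geometric_cauchyC => k; rewrite -perE; have [] := tS k.
have Dp : D p.
  apply: clD => d d0; have [k hk] := geometric_lt (4 * P) d0.
  by exists (t k).1.1; [case: (bad k) => -[] | exact: le_lt_trans (hp k) hk].
have [l hl] := derivable_approx (hD _ Dp).
(* All vertices of the k-th triangle lie within 5P / 2^k of [p]: 4P / 2^k for the first vertex, plus
   one perimeter. The factor 1/5 compensates for this, so the remainder is at most [e] times the
   perimeter there. *)
have [d d0 hd] := hl (e / 5) ltac:(lra).
have [k hk] := geometric_lt (5 * P) d0.
have [_] := bad k; apply; exists 0%N => N _.
case E : (t k) (hp k) (perE k) => [[x y] z] /=; rewrite /per /= => hx perk.
have xy := nm_ge0 (y - x); have yz := nm_ge0 (z - y); have zx := nm_ge0 (x - z).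
pose B := [set w | nm (w - p) <= 5 * (P / 2 ^+ k)].
have cB : midconvex B := @midpt_nm _ _ _.
have Bx : B x.
  rewrite /B /= -perk; move: hx; rewrite -mulrA -perk.
  by have := perimeter_ge0 x y z; lra.
have By : B y.
  rewrite /B /= -perk; move: hx; rewrite -mulrA -perk.
  have -> : y - p = (y - x) + (x - p) by rewrite addrA subrK.
  by have := nmD (y - x) (x - p); rewrite /perimeter; lra.
have Bz : B z.
  rewrite /B /= -perk; move: hx; rewrite -mulrA -perk.
  have -> : z - p = (z - x) + (x - p) by rewrite addrA subrK.
  by have := nmD (z - x) (x - p); rewrite (nmB z x) /perimeter; lra.
pose aff w := h p - l * p + l * w.
pose rem w := h w - aff w.
have hrem w : B w -> nm (rem w) <= e * (P / 2 ^+ k).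
  rewrite /B /= => Bw; have -> : rem w = h w - (h p + l * (w - p)).
    by rewrite /rem /aff; ring.
  have := hd w; have -> : nm (w - p) < d by apply: le_lt_trans Bw _; rewrite mulrA.
  move=> /(_ isT) /le_trans; apply.
  by move: Bw e0; set u := nm _; set v := P / _; nra.
have sumE u v : midsum h N u v = midsum aff N u v + midsum rem N u v.
  rewrite -midsumD; congr (midsum _ _ _ _); apply/funext => w.
  by rewrite /rem addrC subrK.
(* The sums of the affine part are exact, and they cancel around the triangle. The bound then holds
   at every level [N]. *)
have -> : trisum h N x y z = trisum rem N x y z.
  rewrite /trisum !sumE /aff !midsum_affine /midpt.
  by field; rewrite ?pnatr_eq0.
by rewrite expr2 mulrA {1}perk; exact: (nm_trisum N cB hrem).
Qed.

End Goursat.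

(** * Cauchy estimate and identity theorem *)

Section CauchyEstimate.
Variable R : realType.
Local Notation C := (Cx R).
Local Notation I := ('i%C : C).

Lemma Re_midpt (u a b : C) :
  complex.Re (u * midpt a b) = (complex.Re (u * a) + complex.Re (u * b)) / 2.
Proof.
have -> : u * midpt a b = (u * a + u * b) * (2^-1 : R)%:C%C.
  by rewrite /midpt mulrA mulrDr fmorphV rmorph_nat.
by case: (u * a) => ? ?; case: (u * b) => ? ? /=; rewrite mulr0 subr0.
Qed.

Lemma halfplane_midconvex (u : C) (r : R) :
  midconvex [set z | r <= complex.Re (u * z)].
Proof. by move=> a b /= ha hb; rewrite Re_midpt; lra. Qed.

Lemma halfplane_closed (u : C) (r : R) :
  seq_closed [set z | r <= complex.Re (u * z)].
Proof.
move=> p hp /=; rewrite leNgt; apply/negP => hlt.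
(* Adding 1 keeps the denominator positive even for [u] = 0. *)
pose e := (r - complex.Re (u * p)) / (nm u + 1).
have u1 : 0 < nm u + 1 by rewrite ltr_wpDl// nm_ge0.
have [z /= hz hzp] := hp e ltac:(by rewrite divr_gt0// subr_gt0).
have := ler_Re_nm (u * (z - p)); rewrite mulrBr raddfB /= -mulrBr nmM.
rewrite ler_norml => /andP[_ h1].
have : nm u * nm (z - p) <= (nm u + 1) * nm (z - p) by rewrite ler_wpM2r ?nm_ge0//; lra.
move: hzp; rewrite /e ltr_pdivlMr// mulrC; lra.
Qed.

Lemma disc_closed (r : R) : seq_closed [set z : C | nm z <= r].
Proof.
move=> p hp /=; rewrite leNgt; apply/negP => hlt.
have [z /= hz hzp] := hp (nm p - r) ltac:(by rewrite subr_gt0).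
by have := nmD (p - z) z; rewrite subrK nmB; lra.
Qed.

Lemma disc_midconvex (r : R) : midconvex [set z : C | nm z <= r].
Proof. by have := @midpt_nm R 0 r; rewrite /mkset; under eq_fun do rewrite subr0. Qed.

Lemma midconvexI (D E : set C) : midconvex D -> midconvex E -> midconvex (D `&` E).
Proof. by move=> cD cE a b [Da Ea] [Db Eb]; split; [exact: cD|exact: cE]. Qed.

Lemma seq_closedI (D E : set C) : seq_closed D -> seq_closed E -> seq_closed (D `&` E).
Proof.
move=> cD cE p hp; split; [apply: cD|apply: cE] => e /hp[z [Dz Ez] zp];
  by exists z.
Qed.

(* On the edge from b to i b, and on the part of the triangle (0, b, i b) left
   when its corner at 0 is halved, this linear form is >= 1, resp. >= 1/2. *)
Definition edge_form (b : C) : C := b^-1 * (1 - I).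

Lemma edge_form_b b : b != 0 -> complex.Re (edge_form b * b) = 1.
Proof. by move=> b0; rewrite /edge_form mulrAC mulVf// mul1r /= subr0. Qed.

Lemma edge_form_ib b : b != 0 -> complex.Re (edge_form b * (I * b)) = 1.
Proof.
move=> b0; have -> : edge_form b * (I * b) = I - I * I.
  by rewrite /edge_form; field.
by rewrite /=; lra.
Qed.

Lemma nm_I : nm I = 1.
Proof. by apply: complexI; rewrite -nmE normc_def /= expr0n expr1n add0r sqrtr1. Qed.

(** The form has modulus nm (1 - i) / nm b, and nm (1 - i) is bounded by 2. With [r] = 1 this keeps
    the edge from b to i b at distance at least nm b / 2 from 0. *)
Lemma edge_form_far (r : R) (b z : C) : b != 0 ->
  r <= complex.Re (edge_form b * z) -> r * nm b / 2 <= nm z.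
Proof.
move=> b0 rz; have bp : 0 < nm b by rewrite nm_gt0.
have h1 : nm (1 - I) <= 2 by have := nmD 1 (- I); rewrite nmN nm1 nm_I; lra.
have h2 : r <= nm (edge_form b) * nm z.
  by rewrite -nmM; apply: le_trans rz _; apply: le_trans (ler_norm _) (ler_Re_nm _).
have h3 : r * nm b <= nm (1 - I) * nm z.
  move: h2; rewrite /edge_form nmM nmV -mulrA mulrC ler_pdivlMr//.
have := ler_wpM2r (nm_ge0 z) h1; lra.
Qed.

Section Corner.
Variables (D : set C) (q : C -> C) (M : R).
Hypotheses (cD : midconvex D) (clD : seq_closed D) (D0 : D 0).
Hypotheses (dq : forall z, D z -> z != 0 -> derivable q z 1).
Hypotheses (qM : forall z, D z -> nm (q z) <= M).

(* Of the four children of (0, b, i b), only the one at the corner 0 contains the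
   singularity; Goursat's lemma applies to the others. *)
Lemma trisum_corner_halve b (e : R) : b != 0 -> D b -> D (I * b) -> 0 < e ->
  eventually_le (fun N => trisum q N.+1 0 b (I * b) -
    trisum q N 0 (b / 2) (I * (b / 2))) e.
Proof.
move=> b0 Db Dc e0; set c := I * b.
have m0b : midpt 0 b = b / 2 by rewrite /midpt add0r.
have mc0 : midpt c 0 = I * (b / 2) by rewrite /midpt addr0 mulrA.
pose D' := D `&` [set z | 2^-1 <= complex.Re (edge_form b * z)].
have cD' : midconvex D' by apply: midconvexI => //; exact: halfplane_midconvex.
have clD' : seq_closed D' by apply: seq_closedI => //; exact: halfplane_closed.
have dq' z : D' z -> derivable q z 1.
  move=> [Dz /= hz]; apply: dq => //; apply: contraTneq hz => ->.
  by rewrite mulr0 /= -ltNge invr_gt0.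
have D'b : D' b by split => //=; rewrite edge_form_b//; lra.
have D'c : D' c by split => //=; rewrite edge_form_ib//; lra.
have D'm : D' (midpt b c) by exact: cD'.
have D'0b : D' (midpt 0 b).
  by split; [exact: cD | rewrite /= Re_midpt mulr0 edge_form_b//=; lra].
have D'c0 : D' (midpt c 0).
  by split; [exact: cD | rewrite /= Re_midpt mulr0 edge_form_ib//=; lra].
pose P := perimeter 0 b c / 2.
have P0 : 0 <= P by rewrite divr_ge0// perimeter_ge0.
(* Each of the three children away from 0 has perimeter [P], so their bounds add up to 3 e' P^2,
   which is at most [e]; the 1 excludes a zero denominator. *)
pose e' := e / (3 * (P ^+ 2 + 1)).
have PP : 0 <= P ^+ 2 by rewrite exprn_ge0.
have e'0 : 0 < e' by rewrite divr_gt0//; lra.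
have [_ p2 p3 p4] := perimeter_child 0 b c; rewrite -/P in p2 p3 p4.
have g2 := goursat cD' clD' dq' D'0b D'b D'm e'0.
have g3 := goursat cD' clD' dq' D'c0 D'm D'c e'0.
have g4 := goursat cD' clD' dq' D'0b D'm D'c0 e'0.
have := eventually_leD (eventually_leD g2 g3) g4.
rewrite p2 p3 p4 => g.
apply: (@eventually_le_ext _ _ (fun N => trisum q N.+1 0 b c -
    trisum q N 0 (b / 2) (I * (b / 2))) _ _ (eventually_le_le _ g)).
  by move=> N; rewrite trisumS m0b mc0; ring.
have : e' * (3 * (P ^+ 2 + 1)) = e by rewrite /e' divfK//; apply: lt0r_neq0; lra.
lra.
Qed.

(** The singularity of [q] at 0 is removable because [q] is bounded: after j halvings the corner
    triangle contributes at most [M] times its perimeter, which has shrunk by 2^j. Each halving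
    spends half of the remaining error. *)
Lemma trisum_corner b (e : R) : b != 0 -> D b -> D (I * b) -> 0 < e ->
  eventually_le (fun N => trisum q N 0 b (I * b)) e.
Proof.
have aux j : forall b (e : R), b != 0 -> D b -> D (I * b) -> 0 < e ->
    eventually_le (fun N => trisum q N 0 b (I * b))
      (M * perimeter 0 b (I * b) / 2 ^+ j + e).
  elim: j => [|j IH] {}b {}e b0 Db Dc e0.
    exists 0%N => N _; rewrite expr0 divr1.
    by apply: le_trans (nm_trisum _ cD qM D0 Db Dc) _; lra.
  have b20 : b / 2 != 0 by rewrite mulf_neq0// invr_eq0 pnatr_eq0.
  have Db2 : D (b / 2) by have := cD D0 Db; rewrite /midpt add0r.
  have Dc2 : D (I * (b / 2)) by have := cD D0 Dc; rewrite /midpt add0r mulrA.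
  have e2 : 0 < e / 2 by lra.
  have h1 := IH _ _ b20 Db2 Dc2 e2.
  have h2 := trisum_corner_halve b0 Db Dc e2.
  apply: eventually_leS.
  apply: (eventually_le_ext (fun N => subrK (trisum q N 0 (b / 2) (I * (b / 2))) _)).
  apply: eventually_le_le (eventually_leD h2 h1).
  have -> : perimeter 0 (b / 2) (I * (b / 2)) = perimeter 0 b (I * b) / 2.
    rewrite /perimeter !subr0 !sub0r !nmN mulrA -mulrBl !nmM2; lra.
  rewrite exprS invfM; lra.
move=> b0 Db Dc e0.
have [j hj] := geometric_lt (M * perimeter 0 b (I * b)) (ltac:(lra) : 0 < e / 2).
apply: eventually_le_le (aux j b (e / 2) b0 Db Dc _); lra.
Qed.

End Corner.

(** The form dz / z is invariant under scaling, and already so piece by piece in the sums. *)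
Lemma midsum_inv_scale (k a b : C) N : k != 0 ->
  midsum GRing.inv N (k * a) (k * b) = midsum GRing.inv N a b.
Proof.
move=> k0; have mk x y : midpt (k * x) (k * y) = k * midpt x y.
  by rewrite /midpt -mulrDr mulrA.
elim: N a b => [|N IH] a b /=; rewrite mk ?IH//.
by rewrite -mulrBr invfM mulrACA mulVf// mul1r.
Qed.

(** Here [k] is the direction of the segment and [t] its real parameter length, halved at each
    bisection; every piece contributes at least [m] times its own parameter length. *)
Lemma midsum_Re_ge (D : set C) (f : C -> C) (k : C) (m : R) N a b (t : R) :
  midconvex D -> (forall z, D z -> m <= complex.Re (f z * k)) ->
  D a -> D b -> 0 <= t -> b - a = k * t%:C%C ->
  m * t <= complex.Re (midsum f N a b).
Proof.
move=> cD fm; elim: N a b t => [|N IH] a b t Da Db t0 ba /=.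
  have := fm _ (cD _ _ Da Db); rewrite ba mulrA.
  case: (_ * k) => x y /=; rewrite mulr0 subr0 => mx.
  exact: ler_wpM2r.
have t2 : 0 <= t / 2 by lra.
have Dm := cD _ _ Da Db.
have tE : (t / 2)%:C%C = t%:C%C / 2 :> C by rewrite rmorphM /= fmorphV rmorph_nat.
rewrite raddfD /=.
have := IH a (midpt a b) _ Da Dm t2; have := IH (midpt a b) b _ Dm Db t2.
by rewrite midptB1 midptB2 ba tE -mulrA => /(_ erefl) h1 /(_ erefl) h2; lra.
Qed.

(** The sum from 1 to i approximates the integral of dz / z, which is i pi / 2. After multiplication
    by -i, the integrand along x + y = 1 in the direction i - 1 has real part (x + y) / (x^2 + y^2),
    which is at least 1. *)
Lemma midsum_inv_quarter (b : C) N : b != 0 ->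
  midsum GRing.inv N b (I * b) = midsum GRing.inv N 1 I /\
  1 <= nm (midsum (GRing.inv : C -> C) N 1 I).
Proof.
move=> b0; split; first by rewrite -{1}[b]mulr1 (mulrC I) midsum_inv_scale.
pose D : set C := [set z | [/\ complex.Re z + complex.Im z = 1,
  0 <= complex.Re z & 0 <= complex.Im z]].
have cD : midconvex D.
  move=> u v [u1 u2 u3] [v1 v2 v3].
  have -> : midpt u v = complex.Complex ((complex.Re u + complex.Re v) / 2)
      ((complex.Im u + complex.Im v) / 2) :> C.
    rewrite /midpt; have -> : (2 : C) = (2 : R)%:C%C by rewrite rmorph_nat.
    rewrite -fmorphV; case: u {u1 u2 u3} => ? ?; case: v {v1 v2 v3} => ? ?.
    by apply/eqP; rewrite eq_complex /= !mulr0 subr0 add0r !eqxx.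
  by split => /=; lra.
have -> : nm (midsum (GRing.inv : C -> C) N 1 I) =
    nm (midsum (fun z => - I * z^-1) N 1 I).
  by rewrite midsumZ nmM nmN nm_I mul1r.
apply: le_trans (le_trans (ler_norm _) (ler_Re_nm _)).
rewrite -[leLHS]mulr1; apply: (@midsum_Re_ge D _ (I - 1)) => //.
- move=> [x y] [/= xy x0 y0].
  have yE : y = 1 - x by lra.
  have xy0 : 0 < x ^+ 2 + y ^+ 2 by rewrite yE; have := sqr_ge0 (x - 2^-1); nra.
  have inv1 : 1 <= (x ^+ 2 + y ^+ 2)^-1 by rewrite invf_ge1// yE; nra.
  rewrite /= [leRHS](_ : _ = (x + y) / (x ^+ 2 + y ^+ 2)); last by ring.
  by rewrite xy mul1r.
- by split => /=; lra.
- by split => /=; lra.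
- by rewrite mulr1.
Qed.

(** The constant 4 compares the bound 4 M on each of the four boundary edges with a sum of 1 / z of
    modulus at least 1. The bound [M0] on the whole disc serves only to make the difference quotient
    at 0 bounded, so it may be arbitrarily bad. *)
Lemma cauchy_estimate (h : C -> C) (r M M0 : R) : 0 < r ->
  (forall z, nm z <= r -> derivable h z 1) ->
  (forall z, nm z <= r -> nm (h z) <= M0) ->
  (forall z, r / 2 <= nm z -> nm z <= r -> nm (h z) <= M) ->
  nm (h 0) <= 4 * M.
Proof.
move=> r0 dh hM0 hM.
pose D := [set z : C | nm z <= r].
have cD : midconvex D by exact: disc_midconvex.
have clD : seq_closed D by exact: disc_closed.
have D0 : D 0 by rewrite /D /= nm0 ltW.
(* Summing trisum q over the four triangles (0, i^k r, i^(k+1) r) cancels the radial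
   edges, and each boundary edge contributes the same midpoint sum of 1/z, whose
   modulus is at least 1. *)
pose q z := (h z - h 0) * z^-1.
(* Within distance [d] of 0 the derivative [l] bounds the quotient by nm l + 1; farther away the
   numerator is at most 2 M0 and the denominator at least [d]. *)
have [Mq hq] : exists Mq, forall z, D z -> nm (q z) <= Mq.
  have [l /(_ 1 ltr01)[d d0 hd]] := derivable_approx (dh 0 D0).
  exists (Num.max (nm l + 1) ((2 * M0) / d)) => z Dz.
  have [zd|zd] := ltP (nm z) d; rewrite le_max; apply/orP; [left|right].
    have [->|z0] := eqVneq z 0; first by rewrite /q subrr mul0r nm0 addr_ge0 ?nm_ge0.
    have zp : 0 < nm z by rewrite nm_gt0.
    have := hd z; rewrite subr0 => /(_ zd) hz.
    rewrite /q nmM nmV ler_pdivrMr//.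
    have -> : h z - h 0 = (h z - (h 0 + l * z)) + l * z by ring.
    by have := nmD (h z - (h 0 + l * z)) (l * z); rewrite nmM; lra.
  have zp : 0 < nm z by apply: lt_le_trans zd.
  rewrite /q nmM nmV; have := nmD (h z) (- h 0); rewrite nmN.
  have := hM0 z Dz; have := hM0 0 D0 => h1 h2 h3.
  have M00 : 0 <= M0 by have := nm_ge0 (h 0); lra.
  apply: ler_pM; rewrite ?nm_ge0 ?invr_ge0 ?nm_ge0 ?lef_pV2 ?posrE//; lra.
have dq z : D z -> z != 0 -> derivable q z 1.
  move=> Dz z0; apply: derivableM; last by apply: derivableV => //; exact: derivable_id.
  by apply: derivableB; [exact: dh | exact: derivable_cst].
have nmIz z : nm (I * z) = nm z by rewrite nmM nm_I mul1r.
have edge (b : C) : nm b = r ->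
    [/\ b != 0, D b, D (I * b) & forall N,
      nm (midsum q N b (I * b) + h 0 * midsum GRing.inv N 1 I) <= 4 * M].
  move=> br; have b0 : b != 0 by rewrite -nm_gt0 br.
  have Db : D b by rewrite /D /= br.
  have DIb : D (I * b) by rewrite /D /= nmIz br.
  split => // N.
  have -> : midsum q N b (I * b) + h 0 * midsum GRing.inv N 1 I =
      midsum (fun z => h z * z^-1) N b (I * b).
    rewrite -(midsum_inv_quarter N b0).1 -midsumZ -midsumD.
    by congr (midsum _ _ _ _); apply/funext => z; rewrite /q; ring.
  (* On [E] the modulus is at least r / 2, so [M] bounds [h] there and M (2 / r) bounds h / z. The
     edge has length at most 2 r, whence 4 M. *)
  pose E := D `&` [set z | 1 <= complex.Re (edge_form b * z)].
  have cE : midconvex E by apply: midconvexI => //; exact: halfplane_midconvex.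
  have Eb : E b by split => //=; rewrite edge_form_b.
  have EIb : E (I * b) by split => //=; rewrite edge_form_ib.
  have M00 : 0 <= M by apply: le_trans (nm_ge0 _) (hM b _ _); rewrite br //; lra.
  have hE z : E z -> nm (h z * z^-1) <= M * (2 / r).
    move=> [Dz /= /(edge_form_far b0)]; rewrite mul1r br => rz.
    have zp : 0 < nm z by lra.
    rewrite nmM nmV; apply: ler_pM; rewrite ?nm_ge0 ?invr_ge0 ?nm_ge0 ?hM//.
    by rewrite -[leRHS]invrK invf_div lef_pV2 ?posrE//; lra.
  apply: le_trans (nm_midsum N cE hE Eb EIb) _.
  have : nm (I * b - b) <= 2 * r by have := nmD (I * b) (- b); rewrite nmN nmIz br; lra.
  have Mr : 0 <= M * (2 / r) by rewrite mulr_ge0// divr_ge0// ltW.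
  move=> /(ler_wpM2l Mr) /le_trans; apply.
  by rewrite le_eqVlt; apply/orP; left; apply/eqP; field; exact: lt0r_neq0.
(* With [e] allowed for each of the four triangles, 4 nm (h 0) is bounded by 16 M + 4 e. *)
apply/ler_addgt0Pr => e e0.
pose b : C := r%:C%C.
have b1 : nm b = r by apply: complexI; rewrite -nmE ger0_norm ?lecR ?ltW.
have [b0 Db DIb hb] := edge _ b1.
have [c0 Dc DIc hc] := edge (I * b) ltac:(by rewrite nmIz).
have [d0 Dd DId hd] := edge (I * (I * b)) ltac:(by rewrite !nmIz).
have [f0 Df DIf hf] := edge (I * (I * (I * b))) ltac:(by rewrite !nmIz).
have I4 : I * (I * (I * (I * b))) = b.
  have II z : I * (I * z) = - z.
    case: z => x y; apply/eqP; rewrite eq_complex /=; apply/andP.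
    by split; apply/eqP; ring.
  by rewrite !II opprK.
have tb := trisum_corner cD clD D0 dq hq b0 Db DIb e0.
have tc := trisum_corner cD clD D0 dq hq c0 Dc DIc e0.
have td := trisum_corner cD clD D0 dq hq d0 Dd DId e0.
have tf := trisum_corner cD clD D0 dq hq f0 Df DIf e0.
have [N0] := eventually_leD (eventually_leD (eventually_leD tb tc) td) tf.
move=> /(_ N0 (leqnn _)).
have := hb N0; have := hc N0; have := hd N0; have := hf N0.
rewrite I4 /trisum.
have w1 := (midsum_inv_quarter N0 b0).2.
rewrite (midsumC q N0 0 b) (midsumC q N0 0 (I * b)) (midsumC q N0 0 (I * (I * b))).
rewrite (midsumC q N0 0 (I * (I * (I * b)))).
set s1 := midsum q N0 b _; set s2 := midsum q N0 (I * b) _.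
set s3 := midsum q N0 (I * (I * b)) _; set s4 := midsum q N0 (I * (I * (I * b))) b.
set w := midsum _ _ _ _ in w1 *.
set x1 := midsum q _ _ _; set x2 := midsum q _ _ _; set x3 := midsum q _ _ _.
set x4 := midsum q _ _ _ => k4 k3 k2 k1.
have -> : x1 + s1 + - x2 + (x2 + s2 + - x3) + (x3 + s3 + - x4) + (x4 + s4 + - x1) =
  s1 + s2 + s3 + s4 by ring.
move=> ks.
have l1 : nm (s1 + s2 + s3 + s4 + 4 * (h 0 * w)) <= 16 * M.
  have -> : s1 + s2 + s3 + s4 + 4 * (h 0 * w) =
    (s1 + h 0 * w) + (s2 + h 0 * w) + (s3 + h 0 * w) + (s4 + h 0 * w) by ring.
  have := nmD (s1 + h 0 * w + (s2 + h 0 * w) + (s3 + h 0 * w)) (s4 + h 0 * w).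
  have := nmD (s1 + h 0 * w + (s2 + h 0 * w)) (s3 + h 0 * w).
  have := nmD (s1 + h 0 * w) (s2 + h 0 * w); lra.
have l2 := nmD (s1 + s2 + s3 + s4 + 4 * (h 0 * w)) (- (s1 + s2 + s3 + s4)).
move: l2; rewrite nmN addrAC subrr add0r !nmM.
have -> : nm (4 : C) = 4 by rewrite /nm normr_nat -(rmorph_nat (real_complex R)).
have := ler_wpM2l (nm_ge0 (h 0)) w1; lra.
Qed.

End CauchyEstimate.

(** * Identity theorem on a disc, and products of holomorphic germs *)

Section IdentityTheorem.
Variable R : realType.
Local Notation C := (Cx R).

Lemma derivable_line (n : nat) (g : Cn R n -> C) (a v : Cn R n) (t : C) :
  differentiable g (a + t *: v) -> derivable (fun s : C => g (a + s *: v)) t 1.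
Proof.
move=> /(@diff_derivable _ _ _ _ _ v); rewrite /derivable.
under eq_fun do rewrite /=.
under [in X in _ -> X]eq_fun do rewrite /=.
suff -> : (fun h : C => h^-1 *: (g (h *: v + (a + t *: v)) - g (a + t *: v))) =
  (fun h => h^-1 *: (g (a + (h%:A + t) *: v) - g (a + t *: v))) by [].
apply/funext => h; rewrite [_%:A]mulr1 scalerDl.
by rewrite addrCA.
Qed.

Lemma derivable_near0 (g : C -> C) (t : C) (d : R) : 0 < d ->
  (forall s, nm (s - t) < d -> g s = 0) -> derivable g t 1.
Proof.
move=> d0 g0; apply: (@near_eq_derivable _ _ _ (cst 0)); last first.
- exact: derivable_cst.
- near=> s; rewrite g0//=; near: s.
  have d0C : 0 < (d%:C%C : C) by rewrite ltcR.
  apply/nbhs_ballP; exists (d%:C%C) => //= s.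
  by rewrite -ball_normE /ball_ /= nm_lt nmB.
Unshelve. all: by end_near. Qed.

Lemma derivable_shift (g : C -> C) (a t : C) :
  derivable g (a + t) 1 -> derivable (fun s => g (a + s)) t 1.
Proof.
rewrite /derivable.
suff -> : (fun h : C => h^-1 *: ((g \o shift (a + t)) (h *: 1) - g (a + t))) =
    (fun h => h^-1 *: (((fun s => g (a + s)) \o shift t) (h *: 1) - g (a + t))) by [].
by apply/funext => h /=; rewrite addrCA.
Qed.

(** Since [g] vanishes near 0, its quotient by t^n, which is 0 at t = 0, is differentiable on the
    whole disc. *)
Lemma identity_disc (g : C -> C) (B d : R) : 0 < d ->
  (forall t, nm t <= 7 -> derivable g t 1) ->
  (forall t, nm t <= 7 -> nm (g t) <= B) ->
  (forall t, nm t < d -> g t = 0) -> g 1 = 0.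
Proof.
move=> d0 dg gB g0; pose h n t := g t * (t ^+ n)^-1.
have h0 n t : nm t < d -> h n t = 0 by move=> td; rewrite /h g0// mul0r.
have B0 : 0 <= B by apply: le_trans (nm_ge0 _) (gB 0 _); rewrite nm0.
have dh n t : nm t <= 7 -> derivable (h n) t 1.
  move=> t7; have [->|t0] := eqVneq t 0.
    by apply: (derivable_near0 d0) => s; rewrite subr0; exact: h0.
  apply: derivableM; first exact: dg.
  apply: derivableV; first by rewrite expf_neq0.
  exact: exprn_derivable.
have hB n (r : R) t : 0 < r -> r <= nm t -> nm t <= 7 -> nm (h n t) <= B / r ^+ n.
  move=> r0 rt t7; have tp := lt_le_trans r0 rt.
  rewrite /h nmM nmV nmX; apply: ler_pM;
    rewrite ?nm_ge0 ?invr_ge0 ?exprn_ge0 ?nm_ge0 ?gB//.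
  rewrite lef_pV2 ?posrE ?exprn_gt0//.
  by apply: lerXn2r; rewrite ?nnegrE ?nm_ge0// ltW.
have inD (s : C) : nm s <= 6 -> nm (1 + s) <= 7 by have := nmD 1 s; rewrite nm1; lra.
have est n : nm (g 1) <= 4 * B / 2 ^+ n.
  have -> : g 1 = h n (1 + 0) by rewrite /h addr0 expr1n invr1 mulr1.
  (* The disc of radius 6 around 1 lies in that of radius 7 around 0, and on its outer annulus, 3 <=
     nm s, one has nm (1 + s) >= 2; this gives B / 2^n. The bound B / d^n on the whole disc grows
     with n when d < 1, but the estimate does not involve it. *)
  rewrite -mulrA; apply: (@cauchy_estimate _ (fun s => h n (1 + s)) 6 _
    (B / d ^+ n)) => //.
  - by move=> s /inD s7; apply: derivable_shift; exact: dh.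
  - move=> s /inD s7; have [sd|sd] := ltP (nm (1 + s)) d; last exact: hB.
    by rewrite h0// nm0 divr_ge0// exprn_ge0// ltW.
  - move=> s s3 /inD s7; apply: hB => //.
    by have := nmD (1 + s) (-1); rewrite nmN nm1 addrAC subrr add0r; lra.
apply/eqP; rewrite -nm_eq0 eq_le nm_ge0 andbT; apply/ler_addgt0Pr => e e0.
have [n hn] := geometric_lt (4 * B) e0.
by rewrite add0r (le_trans (est n))// ltW.
Qed.

(** Otherwise there are [a] and [b] close to 0 with f a and g b nonzero. Along t |-> a + t (b - a),
    [f] stays nonzero near t = 0, so [g] vanishes there, hence also at t = 1, which is [b]. *)
Lemma holomorphic_germ_domain (n : nat) (f g : Cn R n -> C) :
  holomorphic_near0 f -> holomorphic_near0 g ->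
  vanishes_near0 (fun z => f z * g z) ->
  vanishes_near0 f \/ vanishes_near0 g.
Proof.
move=> hf hg fg0; apply: contrapT => /not_orP[nf ng].
have g00 : differentiable g 0 := nbhs_singleton hg.
have bg : \forall z \near (0 : Cn R n), `|g z| <= `|g 0| + 1.
  have /cvgrPdist_le /(_ 1 ltr01) := differentiable_continuous g00.
  apply: filterS => z hz; rewrite -lerBlDl; apply: le_trans hz.
  by rewrite distrC lerB_dist.
have /nbhs_ballP[r /= r0 hr] : \forall z \near (0 : Cn R n),
   [/\ differentiable f z, differentiable g z, f z * g z = 0 & `|g z| <= `|g 0| + 1].
  by near=> z; split; near: z.
(* For nm t <= 7, the norm of a + t (b - a) is then less than r / 15 + 7 (2 r / 15) = r. *)
have e0 : 0 < r / 15 by rewrite divr_gt0.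
have witness (u : Cn R n -> C) : ~ vanishes_near0 u ->
    exists2 a : Cn R n, `|a| < r / 15 & u a != 0.
  move=> nu; apply: contrapT => na; apply: nu.
  apply/nbhs_ballP; exists (r / 15) => //= z.
  rewrite -ball_normE /ball_ /= sub0r normrN => zr.
  by apply: contrapT => /eqP uz; apply: na; exists z.
have [a ar fa] := witness _ nf; have [b br gb] := witness _ ng.
have line t : nm t <= 7 -> ball 0 r (a + t *: (b - a)).
  move=> t7; rewrite -ball_normE /ball_ /= sub0r normrN.
  apply: le_lt_trans (ler_normD _ _) _; rewrite normrZ.
  have t7' : `|t| <= 7 by rewrite -[7](rmorph_nat (real_complex R)) nm_le.
  have ab : `|b - a| <= r / 15 + r / 15.
    by apply: le_trans (ler_normB _ _) _; rewrite lerD ?ltW.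
  apply: (@lt_le_trans _ _ (r / 15 + 7 * (r / 15 + r / 15))).
    rewrite ltr_leD//; apply: ler_pM => //.
  rewrite le_eqVlt; apply/orP; left; apply/eqP; field; by rewrite ?pnatr_eq0.
have df t : nm t <= 7 -> derivable (fun s : C => f (a + s *: (b - a))) t 1.
  by move=> /line /hr[? _ _ _]; apply: derivable_line.
have dg t : nm t <= 7 -> derivable (fun s : C => g (a + s *: (b - a))) t 1.
  by move=> /line /hr[_ ? _ _]; apply: derivable_line.
have gB t : nm t <= 7 -> nm (g (a + t *: (b - a))) <= nm (g 0) + 1.
  by move=> /line /hr[_ _ _]; rewrite nmE -(rmorph1 (real_complex R)) -rmorphD /= nm_le.
have f0 : (fun s : C => f (a + s *: (b - a))) 0 != 0 by rewrite scale0r addr0.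
have n07 : nm (0 : C) <= 7 by rewrite nm0.
have c0 := differentiable_continuous ((derivable1_diffP _ _).1 (df 0 n07)).
have near0 : \forall t \near (0 : C), f (a + t *: (b - a)) != 0.
  exact: (cvgr_neq0 _ c0 f0).
have /nbhs_ballP[d /= d0 hd] := near0.
have nd0 : 0 < nm d by rewrite nm_gt0 gt_eqF.
move: hd; rewrite -(gtr0_norm d0) nmE => hd.
(* The minimum with 7 keeps the line inside the ball where the product vanishes. *)
have d70 : 0 < Num.min (nm d) 7 by rewrite lt_min nd0 ltr0n.
have := @identity_disc _ _ _ d70 dg gB.
rewrite scale1r [a + (b - a)]addrC subrK => g1.
move/negP: gb; apply; apply/eqP/g1 => t; rewrite lt_min => /andP[td t7].
have := hd t; rewrite -ball_normE /ball_ /= sub0r normrN nm_lt => /(_ td) ft.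
have [_ _ /eqP + _] := hr _ (line _ (ltW t7)).
by rewrite mulf_eq0 (negbTE ft) => /eqP.
Unshelve. all: by end_near. Qed.
End IdentityTheorem.

(** * The form i_X vol / D *)

Section RowReplacement.
Variable F : comPzRingType.

Definition set_row n (M : 'M[F]_n) (i : 'I_n) (u : 'rV[F]_n) : 'M[F]_n :=
  \matrix_(k, j) (if k == i then u 0 j else M k j).

Lemma det_set_row n (M : 'M[F]_n) i u :
  \det (set_row M i u) = \sum_j u 0 j * cofactor M i j.
Proof.
rewrite (expand_det_row _ i); apply: eq_bigr => j _; rewrite mxE eqxx.
congr (_ * (_ * \det _)); apply/matrixP => k l.
by rewrite !mxE eq_sym (negbTE (neq_lift _ _)).
Qed.

(** Cofactor expansion identifies the sum with the trace of M L adj(M), and adj(M) M is scalar. *)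
Lemma sum_det_set_row n (M L : 'M[F]_n) :
  \sum_i \det (set_row M i (row i M *m L)) = \tr L * \det M.
Proof.
transitivity (\tr (M *m L *m \adj M)).
  apply: eq_bigr => i _; rewrite det_set_row mxE.
  by apply: eq_bigr => j _; rewrite -row_mul !mxE.
rewrite -mulmxA mxtrace_mulC -mulmxA mul_adj_mx mul_mx_scalar linearZ /=.
by rewrite mulrC.
Qed.

(** Cramer's rule without division, hence valid for singular [M] too. *)
Lemma cramer_rows n (M : 'M[F]_n) (u : 'rV[F]_n) :
  \sum_i \det (set_row M i u) *: row i M = \det M *: u.
Proof.
rewrite -mul_mx_scalar -mul_adj_mx mulmxA; apply/rowP => l.
rewrite summxE mxE; apply: eq_bigr => i _.
by rewrite !mxE det_set_row; congr (_ * _); apply: eq_bigr => j _; rewrite mxE.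
Qed.

Lemma det_set_row1 n (j : 'I_n) (u : 'rV[F]_n) : \det (set_row 1%:M j u) = u 0 j.
Proof.
have := congr1 (fun v : 'rV_n => v 0 j) (cramer_rows 1%:M u).
rewrite det1 scale1r summxE => <-; rewrite (bigD1 j)//= big1 => [|i ij].
  by rewrite !mxE eqxx mulr1 addr0.
by rewrite !mxE (negbTE ij) mulr0.
Qed.

(** Moving [u] from row [i] to the top costs [i] transpositions. This sign cancels the one in
    [extd]. *)
Lemma det_col_mx_row' n (A : 'M[F]_n.+1) (u : 'rV[F]_n.+1) i :
  \det (col_mx u (row' i A) : 'M_(1 + n)) = (-1) ^+ i * \det (set_row A i u).
Proof.
rewrite det_set_row (expand_det_row _ (lshift n 0)) mulr_sumr.
apply: eq_bigr => j _; rewrite col_mxEu [RHS]mulrCA; congr (_ * _).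
rewrite /cofactor mulrA -exprD addnA addnn (exprD _ i.*2) -mul2n exprM.
rewrite sqrrN !expr1n mul1r.
congr (_ * \det _); apply/matrixP => k l.
have liftE : lift (lshift n (0 : 'I_1)) k = rshift 1 k by exact: val_inj.
by rewrite mxE mxE liftE col_mxEd !mxE.
Qed.

End RowReplacement.

(** * Differentials of products, quotients and determinants *)

Section DetDiff.
Variables (K : numFieldType) (V : normedModType K).

Lemma is_diff_bigsum (I : Type) (r : seq I) (f df : I -> V -> K) x :
  (forall i, is_diff x (f i) (df i)) ->
  is_diff x (fun y => \sum_(i <- r) f i y) (fun v => \sum_(i <- r) df i v).
Proof.
move=> fd; elim: r => [|i r IH].
  under eq_fun do rewrite big_nil; under [X in is_diff _ _ X]eq_fun do rewrite big_nil.
  exact: is_diff_cst.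
under eq_fun do rewrite big_cons; under [X in is_diff _ _ X]eq_fun do rewrite big_cons.
exact: is_diffD.
Qed.

(** Leibniz rule written with one factor replaced, so that summing over permutations yields
    determinants of [set_row]. *)
Lemma is_diff_bigprod n (f df : 'I_n -> V -> K) x :
  (forall i, is_diff x (f i) (df i)) ->
  is_diff x (fun y => \prod_i f i y)
    (fun v => \sum_i \prod_k (if k == i then df k v else f k x)).
Proof.
elim: n f df => [|n IH] f df fd.
  under eq_fun do rewrite big_ord0; under [X in is_diff _ _ X]eq_fun do rewrite big_ord0.
  exact: is_diff_cst.
under eq_fun do rewrite big_ord_recl.
have dM := @is_diffM _ _ _ _ _ _ _ (fd ord0) (IH _ _ (fun i => fd (lift ord0 i))).
apply: is_diff_eq; apply/funext => v /=; rewrite [RHS]big_ord_recl big_ord_recl eqxx /=.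
rewrite /GRing.add /GRing.scale /= addrC; congr (_ + _).
  by rewrite mulrC.
rewrite /GRing.scale /= mulr_sumr; apply: eq_bigr => i _; rewrite big_ord_recl.
by congr (_ * _).
Qed.

Lemma is_diff_quotient (f g df dg : V -> K) x :
  g x != 0 -> is_diff x f df -> is_diff x g dg ->
  is_diff x (fun y => f y / g y)
    (fun v => (df v - f x / g x * dg v) / g x).
Proof.
move=> gx fd gd.
have gV : is_diff x (fun y => (g y)^-1) (fun v => - (g x) ^- 2 * dg v).
  apply: DiffDef; first exact: differentiableV.
  by rewrite diffV// diff_val.
apply: is_diff_eq (is_diffM fd gV) _.
apply/funext => v.
transitivity (f x * (- (g x) ^- 2 * dg v) + (g x)^-1 * df v); first by [].
by field.
Qed.

Lemma is_diff_det n (f df : V -> 'M[K]_n) x :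
  (forall i j, is_diff x (fun y => f y i j) (fun v => df v i j)) ->
  is_diff x (fun y => \det (f y))
    (fun v => \sum_i \det (set_row (f x) i (row i (df v)))).
Proof.
move=> fd; rewrite /determinant.
pose dterm (s : 'S_n) v := (-1) ^+ s *
  (\sum_i \prod_k (if k == i then df v k (s k) else f x k (s k))) : K.
apply: (@is_diff_eq _ _ _ _ (fun v => \sum_(s : 'S_n) dterm s v)).
  apply: is_diff_bigsum => s.
  have dp := @is_diff_bigprod _ _ _ _ (fun i => fd i (s i)).
  exact: (@is_diffZ _ _ _ _ _ ((-1) ^+ s) _ dp).
apply/funext => v; rewrite /dterm.
under eq_bigr do rewrite mulr_sumr.
rewrite exchange_big /=; apply: eq_bigr => i _; apply: eq_bigr => s _.
congr (_ * _); apply: eq_bigr => k _; rewrite !mxE.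
by case: eqP => // ->.
Qed.

End DetDiff.

(** * The frame determinant D and the form i_X vol *)

Section VectorFields.
Variable R : realType.
Local Notation C := (Cx R).

Lemma is_diff_coord n (f : Cn R n -> Cn R n) (z : Cn R n) (j : 'I_n) :
  differentiable f z ->
  is_diff z (fun y => f y 0 j : C) (fun v => 'd f z v 0 j).
Proof.
move=> /differentiableP df.
have @c : {linear 'rV[C]_n -> C}.
  by exists (fun N : 'rV[C]_n => N 0 j); do 2![eexists]; do ?[constructor];
     rewrite ?mxE// => ? *; rewrite ?mxE//; move=> ?; rewrite !mxE.
have cc : continuous c by exact: coord_continuous.
have dc : is_diff (f z) c c.
  by apply: DiffDef; [exact: linear_differentiable | rewrite diff_lin].
exact: (@is_diff_comp _ _ _ _ _ _ _ _ _ df dc).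
Qed.

Definition frame_mx n (Y : 'I_n -> Cn R n -> Cn R n) (z : Cn R n) : 'M[C]_n :=
  \matrix_i Y i z.

Lemma is_diff_det_frame n (Y : 'I_n -> Cn R n -> Cn R n) z :
  (forall i, differentiable (Y i) z) ->
  is_diff z (fun y => \det (frame_mx Y y) : C)
    (fun v => \sum_i \det (set_row (frame_mx Y z) i ('d (Y i) z v))).
Proof.
move=> dY.
apply: is_diff_eq (is_diff_det (df := fun v => \matrix_i 'd (Y i) z v) _) _.
  move=> i j; under eq_fun do rewrite mxE.
  under [X in is_diff _ _ X]eq_fun do rewrite mxE.
  exact: is_diff_coord.
by apply/funext => v; apply: eq_bigr => i _; rewrite rowK.
Qed.

Lemma jacobianE n (f : Cn R n -> Cn R n) z v : 'd f z v = v *m lin1_mx ('d f z).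
Proof. by rewrite mul_rV_lin1. Qed.

(** This is X(D) = div(X) D: commutation replaces the derivative of Y_i along X by that of X along
    Y_i, which is row [i] of the frame times the Jacobian of X, and [sum_det_set_row] applies. *)
Lemma diff_det_frame_commute n (X : Cn R n -> Cn R n)
    (Y : 'I_n -> Cn R n -> Cn R n) z :
  (forall i, differentiable (Y i) z) ->
  (forall i, lie_bracket X (Y i) z = 0) ->
  'd (fun y => \det (frame_mx Y y) : C) z (X z) =
  \tr (lin1_mx ('d X z)) * \det (frame_mx Y z).
Proof.
move=> dY XY; have dd := is_diff_det_frame dY; rewrite diff_val -sum_det_set_row.
apply: eq_bigr => i _; rewrite rowK -(jacobianE X).
have e : 'd (Y i) z (X z) = 'd X z (Y i z) by exact: subr0_eq (XY i).
by congr (\det (set_row _ _ _)).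
Qed.

Definition interior_vol m (X : Cn R m.+1 -> Cn R m.+1) : formfield R m.+1 m :=
  fun z A => \det (col_mx (X z) A : 'M_(1 + m)).

(** Expansion along the first row gives a linear form in X z with cofactors depending on [A]
    alone. *)
Lemma is_diff_interior_vol m (X : Cn R m.+1 -> Cn R m.+1) z A :
  differentiable X z ->
  is_diff z (fun y => interior_vol X y A : C)
    (fun v => \det (col_mx ('d X z v) A : 'M_(1 + m))).
Proof.
move=> dX.
pose k j : C := cofactor (col_mx 0 A : 'M_(1 + m)) (lshift m 0) j.
have E (u : Cn R m.+1) : \det (col_mx u A : 'M_(1 + m)) = \sum_j k j * u 0 j.
  have -> : col_mx u A = set_row (col_mx 0 A : 'M_(1 + m)) (lshift m 0) u.
    apply/matrixP => a b; rewrite [RHS]mxE; case: (split_ordP a) => a' ->.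
      by have -> : a' = 0 by [exact: ord1]; rewrite eqxx col_mxEu.
    by rewrite eq_rlshift !col_mxEd.
  by rewrite det_set_row; apply: eq_bigr => j _; rewrite mulrC.
rewrite /interior_vol; under eq_fun do rewrite E.
under [X in is_diff _ _ X]eq_fun do rewrite E.
apply: is_diff_bigsum => j.
exact: (@is_diffZ _ _ _ _ _ (k j) _ (is_diff_coord j dX)).
Qed.

Lemma altform_interior_vol m (X : Cn R m.+1 -> Cn R m.+1) z :
  altform (interior_vol X z).
Proof.
split=> [A i a u v upd|A i j ij Aij].
  have row'_upd x y : row' (rshift 1 i) (col_mx (X z) (upd x)) =
      row' (rshift 1 i) (col_mx (X z) (upd y)).
    apply/matrixP => p l; rewrite [LHS]mxE [RHS]mxE.
    case: (split_ordP (lift (rshift 1 i) p)) => k pk; rewrite pk ?col_mxEu//.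
    rewrite !col_mxEd !mxE; case: eqP => // ki.
    by have := neq_lift (rshift 1 i) p; rewrite pk ki eqxx.
  rewrite /interior_vol -[X in _ = _ + X]mul1r.
  apply: (determinant_multilinear (i0 := rshift 1 i)); [|exact: row'_upd..].
  by rewrite !rowKd scale1r; apply/rowP => l; rewrite !mxE eqxx !mxE.
apply: (determinant_alternate (i1 := rshift 1 i) (i2 := rshift 1 j)).
  by apply: contra ij => /eqP/rshift_inj/eqP.
by move=> l; rewrite !col_mxEd; move/rowP: Aij => /(_ l); rewrite !mxE.
Qed.

(** Evaluating on all basis vectors except the j-th gives the j-th coordinate of X z up to sign. *)
Lemma interior_vol_eq0 m (X : Cn R m.+1 -> Cn R m.+1) z :
  (forall A, interior_vol X z A = 0) -> X z = 0.
Proof.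
move=> X0; apply/rowP => j; have := X0 (row' j 1%:M).
rewrite /interior_vol det_col_mx_row' det_set_row1 => /eqP.
by rewrite mulf_eq0 signr_eq0 mxE => /eqP.
Qed.

(** After the quotient rule, the derivatives of X sum to div(X) det A by [sum_det_set_row]. By
    [cramer_rows] the derivatives of D combine into det A times X(D) / D, which is again div(X) det
    A. *)
Lemma extd_interior_vol_quotient m (X : Cn R m.+1 -> Cn R m.+1)
    (Y : 'I_m.+1 -> Cn R m.+1 -> Cn R m.+1) z A :
  differentiable X z -> (forall i, differentiable (Y i) z) ->
  (forall i, lie_bracket X (Y i) z = 0) -> \det (frame_mx Y z) != 0 ->
  extd (fun x B => interior_vol X x B / \det (frame_mx Y x)) z A = 0.
Proof.
move=> dX dY XY Y0.
have dD := differentiableP (@ex_diff _ _ _ _ _ _ _ (is_diff_det_frame dY)).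
have XD := diff_det_frame_commute dY XY.
have dDZ c v : 'd (fun y => \det (frame_mx Y y) : C) z (c *: v) =
    c * 'd (fun y => \det (frame_mx Y y) : C) z v by exact: linearZ.
rewrite /extd.
have termE (i : 'I_m.+1) :
    (-1) ^+ i *
      'd (fun x => interior_vol X x (row' i A) / \det (frame_mx Y x) : (Cx R)^o)
        z (row i A) =
    (\det (set_row A i (row i A *m lin1_mx ('d X z))) -
      (\det (frame_mx Y z))^-1 *
        'd (fun y => \det (frame_mx Y y) : C) z
          (\det (set_row A i (X z)) *: row i A))
    / \det (frame_mx Y z).
  have dq := is_diff_quotient (g := fun y => \det (frame_mx Y y)) Y0
    (is_diff_interior_vol (row' i A) dX) dD.
  have dqi := congr1 (fun f => f (row i A)) (@diff_val _ _ _ _ _ _ _ dq).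
  refine (etrans (congr1 (fun w => (-1) ^+ i * w) dqi) _).
  rewrite dDZ (jacobianE X) /interior_vol !det_col_mx_row'.
  have s2 : (-1) ^+ i * (-1) ^+ i = 1 :> C by rewrite -expr2 sqrr_sign.
  move: s2; set s := (-1) ^+ i; set d1 := \det (set_row _ _ _).
  set d2 := \det (set_row _ _ _); set e := 'd _ _ _; set Dz := \det (frame_mx Y z) => s2.
  by rewrite -[RHS]mul1r -s2; ring.
rewrite (eq_bigr _ (fun i _ => termE i)) -mulr_suml sumrB -mulr_sumr -linear_sum /=.
rewrite cramer_rows sum_det_set_row dDZ XD.
by field.
Qed.

(** The first two rows of the determinant both equal X z. For [m] = 0 the form has degree 0 and the
    interior product is 0 by definition. *)
Lemma interior_interior_vol m (X : Cn R m.+1 -> Cn R m.+1)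
    (D : Cn R m.+1 -> Cx R) z A :
  Defs.interior X (fun x B => interior_vol X x B / D x) z A = 0.
Proof.
case: m X D z A => [|m] X D z A //=.
rewrite /interior_vol (determinant_alternate (i1 := lshift m.+1 (0 : 'I_1))
  (i2 := rshift 1 (lshift m (0 : 'I_1)))) ?mul0r ?eq_lrshift// => j.
by rewrite col_mxEu col_mxEd; exact: (esym (@col_mxEu _ 1 m _ (X z) A 0 j)).
Qed.

End VectorFields.

(** * Construction of the closed meromorphic form *)

Lemma has_indep_centralizer_r_max (R : realType) (n : nat) (X : hvfield R n) :
  has_indep_centralizer X (r_max X).
Proof. by rewrite /r_max; case: ex_maxnP => r /asboolP. Qed.

(* n = 0 is excluded by the hypothesis that X is not identically 0 near 0. *)
Theorem proposition3 (R : realType) (n : nat) (X : hvfield R n) :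
  ~ vanishes_near0 X ->
  r_max X = n ->
  exists eta : mform R n n.-1,
    ~ mzero eta /\ mclosed eta /\ mannihilates eta X.
Proof.
move=> X0 rn; have := has_indep_centralizer_r_max X; rewrite {}rn.
case: n X X0 => [|m] X X0 [Y [YC Yind]].
  by exfalso; apply: X0; apply: filterE => z; apply/rowP => -[].
pose D (z : Cn R m.+1) : (Cx R)^o := \det (frame_mx Y z).
have dY : \forall z \near (0 : Cn R m.+1), forall i, differentiable (Y i) z.
  exact: (filter_forall _ (fun i => vf_hol (Y i))).
have XY : \forall z \near (0 : Cn R m.+1), forall i, lie_bracket X (Y i) z = 0.
  exact: (filter_forall _ YC).
have dX := vf_hol X.
have N_alt : \forall z \near (0 : Cn R m.+1), altform (interior_vol X z).
  by apply: filterE => z; exact: altform_interior_vol.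
have N_hol : \forall z \near (0 : Cn R m.+1), forall A,
    differentiable (fun x => interior_vol X x A : (Cx R)^o) z.
  apply: filterS dX => z dXz A.
  exact: (@ex_diff _ _ _ _ _ _ _ (is_diff_interior_vol A dXz)).
have D_hol : holomorphic_near0 D.
  apply: filterS dY => z dYz.
  exact: (@ex_diff _ _ _ _ _ _ _ (is_diff_det_frame dYz)).
have D_neq0 : ~ vanishes_near0 D.
  (* For as many fields as dimensions, the wedge evaluated on [A] is D z times det A. *)
  move=> D0; apply: Yind; apply: filterS D0 => z Dz A.
  by rewrite /wedge det_mulmx -/(frame_mx Y z) [\det _]Dz mul0r.
exists (MForm N_alt N_hol D_hol D_neq0); split; last split.
- move=> eta0; apply: X0.
  (* Where D is nonzero, vanishing of the form forces X z = 0; elsewhere the factor D is 0. The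
     product thus vanishes on a full neighbourhood, and since D does not, each coordinate of X
     does. *)
  have XD0 j : vanishes_near0 (fun z => X z 0 j * D z : Cx R).
    apply: filterS eta0 => z /= eta0z; have [->|Dz] := eqVneq (D z) 0.
      exact: mulr0.
    rewrite (interior_vol_eq0 (X := X)) ?mxE ?mul0r// => A.
    by have /eqP := eta0z Dz A; rewrite mulf_eq0 invr_eq0 (negbTE Dz) orbF => /eqP.
  have Xj_hol j : holomorphic_near0 (fun z => X z 0 j : (Cx R)^o).
    apply: filterS dX => z dXz.
    exact: (@ex_diff _ _ _ _ _ _ _ (is_diff_coord j dXz)).
  have Xj0 j : vanishes_near0 (fun z => X z 0 j : Cx R).
    by have [//|] := holomorphic_germ_domain (Xj_hol j) D_hol (XD0 j).
  apply: filterS (filter_forall _ Xj0) => z Xz.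
  by apply/rowP => j; rewrite mxE.
- near=> z => Dz A; apply: extd_interior_vol_quotient => //; near: z => //.
- by apply: filterE => z _ A; exact: interior_interior_vol.
Unshelve. all: by end_near. Qed.
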